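(* Let $D=\Lambda\times\{1,-1\}$ be the $\Lambda$-duplicate, with the topology having basis $\{W(r,t,i) : t\in\Lambda,\ i\in\{1,-1\},\ r\in\Lambda\cup\{0\},\ r\prec t\}$. Then the Banach space $C_0(D)$ admits a $C^\infty$-smooth bump function.
   Context: The tree $\Lambda$: $\Lambda$ is the set of all injective functions $t:\alpha\to\omega$, where $\alpha$ is a countable ordinal and $\omega\setminus\operatorname{ran} t$ is infinite; $s\preccurlyeq t$ means that $t$ extends $s$. Write $\operatorname{dom} t$ for the domain of $t$ and $\operatorname{ran} t$ for its range. Let $0$ be an extra element not in $\Lambda$ (distinct from the empty function $\varnothing\in\Lambda$), with $0\prec t$ for all $t\in\Lambda$. For $t\in\Lambda$ and $r\in\Lambda\cup\{0\}$ let $(r,t]=\{s\in\Lambda : r\prec s\preccurlyeq t\}$. The sequences $\tau(s,t)$: for $s,t\in\Lambda$ with $s\prec t$, define ordinals $\operatorname{dom} t=\beta_0>\beta_1>\dots>\beta_k=\operatorname{dom} s$ as follows: given $\beta_i>\operatorname{dom} s$, let $\beta_{i+1}\in[\operatorname{dom} s,\beta_i)$ be the unique ordinal such that $t(\beta_{i+1})\le t(\xi)$ for all $\xi\in[\operatorname{dom} s,\beta_i)$; the process stops at a finite stage $k>0$ with $\beta_k=\operatorname{dom} s$. Put $\tau(s,t)=(\beta_k,\dots,\beta_1)$, and let $\tau(t,t)$ be the empty sequence. Let $\ell(s,t)$ be the length of $\tau(s,t)$. The $\Lambda$-duplicate: $D=\Lambda\times\{1,-1\}$. For $(t,i)\in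 D$ and $r\in\Lambda\cup\{0\}$ with $r\prec t$, let $$W(r,t,i)=\{(s,j)\in D : s\in(r,t]\text{ and } j=(-1)^{\ell(s,t)}i\}.$$ The sets $W(r,t,i)$ form a basis for a locally compact (Hausdorff) topology on $D$; $D$ with this topology is called the $\Lambda$-duplicate. $C_0(D)$ is the Banach space of continuous real-valued functions on $D$ vanishing at infinity, with the supremum norm. A $C^\infty$-smooth bump function on a Banach space is a non-zero real-valued function on it that has Fr\'echet derivatives of all orders and vanishes outside some norm-bounded set. *)

(* Defs.v *)
From HB Require Import structures.
From mathcomp Require Import all_boot all_order all_algebra.
From mathcomp Require Import all_classical all_reals all_analysis.
From mathcomp Require wochoice.
From mathcomp Require Import lra.

Set Implicit Arguments.
Unset Strict Implicit.
Unset Printing Implicit Defensive.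

Import Order.TTheory GRing.Theory Num.Theory.
Import numFieldNormedType.Exports.

Local Open Scope classical_set_scope.
Local Open Scope ring_scope.

(* The first uncountable ordinal. [set nat] is uncountable; fix a well-order
   on it. The elements with countably many predecessors form, under the
   induced order, a well-ordered set of type omega_1 (see [omega1_wo],
   [omega1_initial_countable] and [omega1_uncountable]). Its elements play the
   role of the countable ordinals: [a] stands for the order type of
   [set b | b < a]. *)
Definition wo_nat : rel (set nat) :=
  sval (wochoice.well_ordering_principle (set nat : eqType)).

Lemma wo_natP : wochoice.well_order wo_nat.
Proof. exact: svalP (wochoice.well_ordering_principle _). Qed.

Lemma wo_nat_min (A : set (set nat)) :
  A !=set0 -> exists2 z, A z & forall x, A x -> wo_nat z x.
Proof.
move=> [x Ax]; have [|z [[/asboolP Az lb] _]] := @wo_natP (fun x => `[< A x >]).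
  by exists x; apply/asboolP.
by exists z => // y Ay; apply: lb; apply/asboolP.
Qed.

Lemma wo_nat_total : total wo_nat.
Proof.
move=> x y; have [|z zxy zle] := @wo_nat_min [set x; y]; first by exists x; left.
by case: zxy zle => -> zle; [rewrite zle //; right | rewrite orbC zle //; left].
Qed.

Lemma wo_nat_refl : reflexive wo_nat.
Proof. by move=> x; have := wo_nat_total x x; rewrite orbb. Qed.

Lemma wo_nat_anti : antisymmetric wo_nat.
Proof.
move=> x y /andP[xy yx]; have [|z [_ Uz]] := @wo_natP (pred2 x y).
  by exists x; rewrite inE eqxx.
rewrite -(Uz x) ?(Uz y) //; split; rewrite ?inE ?eqxx ?orbT //.
- by move=> u /pred2P[]->; rewrite ?wo_nat_refl.
- by move=> u /pred2P[]->; rewrite ?wo_nat_refl.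
Qed.

Lemma wo_nat_trans : transitive wo_nat.
Proof.
move=> y x z xy yz.
have [|w [wx|wy|wz] wle] := @wo_nat_min [set u | [\/ u = x, u = y | u = z]].
- by exists x; constructor 1.
- by rewrite -wx wle //; constructor 3.
- suff -> : x = y by [].
  by apply: wo_nat_anti; rewrite xy -wy wle //; constructor 1.
- have zy : y = z by apply: wo_nat_anti; rewrite yz -wz wle //; constructor 2.
  by rewrite -zy.
Qed.

Record omega1 : Type := Omega1 {
  omega1_val :> set nat;
  omega1P : `[< countable [set y | wo_nat y omega1_val] >] }.

HB.instance Definition _ := [isSub of omega1 for omega1_val].
HB.instance Definition _ := [Choice of omega1 by <:].

Definition omega1_le (a b : omega1) : bool := wo_nat a b.

Lemma omega1_le_refl : reflexive omega1_le.
Proof. by move=> a; exact: wo_nat_refl. Qed.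

Lemma omega1_le_anti : antisymmetric omega1_le.
Proof. by move=> a b /wo_nat_anti /val_inj. Qed.

Lemma omega1_le_trans : transitive omega1_le.
Proof. by move=> b a c; exact: wo_nat_trans. Qed.

Fact omega1_display : Order.disp_t. Proof. exact: Order.Disp tt tt. Qed.

HB.instance Definition _ := Order.Le_isPOrder.Build omega1_display omega1
  omega1_le_refl omega1_le_anti omega1_le_trans.

Lemma omega1_total : total (<=%O : rel omega1).
Proof. by move=> a b; exact: wo_nat_total. Qed.

HB.instance Definition _ :=
  Order.POrder_isTotal.Build omega1_display omega1 omega1_total.

Lemma omega1_wo (A : set omega1) :
  A !=set0 -> exists2 a, A a & forall b, A b -> (a <= b)%O.
Proof.
move=> [a Aa]; have [|_ [b Ab <-] le] := @wo_nat_min (omega1_val @` A).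
  by exists (omega1_val a), a.
by exists b => // c Ac; apply: le; exists c.
Qed.

Lemma omega1_ind (P : omega1 -> Prop) :
  (forall a, (forall b, (b < a)%O -> P b) -> P a) -> forall a, P a.
Proof.
move=> IH a; apply: contrapT => nPa.
have [b nPb le] := @omega1_wo [set b | ~ P b] (ex_intro _ a nPa).
by apply: nPb; apply: IH => c cb; apply: contrapT => /le; rewrite leNgt cb.
Qed.

Lemma omega1_initial_countable (a : omega1) : countable [set b | (b <= a)%O].
Proof.
have /asboolP/countable_injP [f fI] := omega1P a.
apply/countable_injP; exists (fun b : omega1 => f b) => b c.
by rewrite !inE => ba ca /fI/val_inj; apply; rewrite inE.
Qed.

Lemma set_nat_uncountable : ~ countable [set: set nat].
Proof.
move/countable_injP=> [f fI].
pose D := [set n | exists2 X, f X = n & ~ X n].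
have /= DE : D (f D) <-> ~ D (f D).
  split=> [[X fXD nX]|nD]; last by exists D.
  by have XD : X = D; [apply: fI; rewrite ?inE | rewrite XD in nX].
have nD : ~ D (f D) by move=> h; exact: (DE.1 h) h.
exact/nD/DE.2.
Qed.

Lemma omega1_uncountable : ~ countable [set: omega1].
Proof.
move=> /countable_injP[f fI].
have cval (A : set (set nat)) : (forall X, A X -> exists a : omega1, X = a) ->
    countable A.
  move=> Aval; apply: (@sub_countable _ _ _ (omega1_val @` setT)).
    by apply: subset_card_le => X /Aval[a ->]; exists a.
  apply: (sub_countable (card_image_le _ _)).
  by apply/countable_injP; exists f.
have [all|] := pselect (forall X, countable [set y | wo_nat y X]).
  apply: set_nat_uncountable; apply: cval => X _.
  by exists (Omega1 (asboolT (all X))).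
move=> /existsNP /(@wo_nat_min [set X | ~ _ X]) [X nX Xmin]; apply: nX.
have -> : [set y | wo_nat y X] = [set y | wo_nat y X /\ y <> X] `|` [set X].
  apply/seteqP; split=> [y /= yX|y /= [[]//|->]]; last exact: wo_nat_refl.
  by have [->|] := pselect (y = X); [right|left].
rewrite -bigcup2E; apply: bigcup_countable => [|[|[|n]] _ /=].
1: exact: countableP.
2: exact: countable1.
2: exact: countable0.
apply: cval => Y [YX neq].
have cY : countable [set y | wo_nat y Y].
  by apply: contrapT => /Xmin XY; apply: neq; apply: wo_nat_anti; rewrite YX.
by exists (Omega1 (asboolT cY)).
Qed.

(* [tfun t] is the graph of an injection of the ordinal [tdom t] into nat with
   co-infinite range; [None] means undefined, so that the extension order is
   inclusion of graphs. *)
Record Lambda : Type := MkLambda {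
  tdom : omega1;
  tfun : omega1 -> option nat;
  tfun_dom : forall a, tfun a != None <-> (a < tdom)%O;
  tfun_inj : forall a b n, tfun a = Some n -> tfun b = Some n -> a = b;
  tfun_coinf : infinite_set [set n | forall a, tfun a <> Some n] }.

HB.instance Definition _ := gen_eqMixin Lambda.
HB.instance Definition _ := gen_choiceMixin Lambda.

Definition tle (s t : Lambda) : Prop :=
  forall a n, tfun s a = Some n -> tfun t a = Some n.

Definition tlt (s t : Lambda) : Prop := s <> t /\ tle s t.

(* [None : option Lambda] is the extra least element 0. *)
Definition tlt0 (r : option Lambda) (t : Lambda) : Prop :=
  if r is Some r' then tlt r' t else True.

(* (r, t] *)
Definition tint (r : option Lambda) (t : Lambda) : set Lambda :=
  [set s | tlt0 r s /\ tle s t].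

(* The value t(a); meaningful for a < tdom t. *)
Definition teval (t : Lambda) (a : omega1) : nat := odflt 0%N (tfun t a).

(* The point of [tdom s, b) where t is smallest; when that interval is empty
   (in particular for b = tdom s) it is b itself. *)
Definition tau_next (s t : Lambda) (b : omega1) : omega1 :=
  xget b [set c | (tdom s <= c < b)%O /\
    forall a, (tdom s <= a < b)%O -> (teval t c <= teval t a)%N].

(* beta_0 = tdom t, beta_1, beta_2, ... *)
Definition tau_beta (s t : Lambda) (i : nat) : omega1 :=
  iter i (tau_next s t) (tdom t).

(* The first stage k with beta_k = tdom s (see [tau_stageP]). *)
Definition tau_stage (s t : Lambda) : nat :=
  xget 0%N [set k | tau_beta s t k = tdom s /\
    forall j, (j < k)%N -> tau_beta s t j <> tdom s].

(* tau(s, t) = (beta_k, ..., beta_1), defined for s below or equal to t. *)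
Definition tau (s t : Lambda) : seq omega1 :=
  rev [seq tau_beta s t i | i <- iota 1 (tau_stage s t)].

Definition tau_len (s t : Lambda) : nat := size (tau s t).

Lemma tau_lenE s t : tau_len s t = tau_stage s t.
Proof. by rewrite /tau_len size_rev size_map size_iota. Qed.

Lemma tfun_None (t : Lambda) a : (tdom t <= a)%O -> tfun t a = None.
Proof.
move=> ta; case E : (tfun t a) => [n|//].
by have /tfun_dom : tfun t a != None; rewrite ?E // ltNge ta.
Qed.

Lemma tfun_Some (t : Lambda) a : (a < tdom t)%O -> tfun t a = Some (teval t a).
Proof. by move=> /tfun_dom; rewrite /teval; case: (tfun t a). Qed.

Lemma LambdaP s t : tfun s =1 tfun t -> s = t.
Proof.
move=> /funext fst; have dst : tdom s = tdom t.
  have D a : (a < tdom s)%O <-> (a < tdom t)%O by rewrite -!tfun_dom fst.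
  by apply/eqP; rewrite eq_le !leNgt; apply/andP; split; apply/negP=> h;
    [have /D := h | have /D := h]; rewrite ltxx.
case: s fst dst => ds fs Ps Qs Rs; case: t => dt ft Pt Qt Rt /= fst dst.
move: Pt Qt Rt; rewrite -fst -dst => Pt Qt Rt.
by congr MkLambda; exact: Prop_irrelevance.
Qed.

Lemma tle_refl t : tle t t. Proof. by []. Qed.

Lemma tle_trans t s u : tle s t -> tle t u -> tle s u.
Proof. by move=> st tu a n /st/tu. Qed.

Lemma tle_dom s t : tle s t -> (tdom s <= tdom t)%O.
Proof.
move=> st; rewrite leNgt; apply/negP => ts.
by have := st _ _ (tfun_Some ts); rewrite tfun_None.
Qed.

Lemma tle_val s t a : tle s t -> (a < tdom s)%O -> teval s a = teval t a.
Proof. by move=> st /tfun_Some/st E; rewrite [RHS]/teval E. Qed.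

Lemma tle_cmp s s' t : tle s t -> tle s' t -> (tdom s <= tdom s')%O -> tle s s'.
Proof.
move=> st s't ss' a n san; have as' : (a < tdom s')%O.
  by apply: lt_le_trans ss'; apply/tfun_dom; rewrite san.
by rewrite tfun_Some // (tle_val s't as') /teval (st _ _ san).
Qed.

Lemma tle_anti s t : tle s t -> tle t s -> s = t.
Proof.
move=> st ts; apply: LambdaP => a.
case E : (tfun s a) => [n|]; first by rewrite (st _ _ E).
by case E' : (tfun t a) => [n|//]; rewrite -E (ts _ _ E').
Qed.

Lemma tlt_dom s t : tlt s t -> (tdom s < tdom t)%O.
Proof.
move=> [nst st]; rewrite ltNge; apply/negP => ts; apply: nst.
exact: tle_anti st (tle_cmp (@tle_refl t) st ts).
Qed.

Lemma tle_tlt s t : tle s t -> (tdom s < tdom t)%O -> tlt s t.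
Proof. by move=> st d; split=> // E; rewrite E ltxx in d. Qed.

Lemma tlt_tle_trans t s u : tlt s t -> tle t u -> tlt s u.
Proof.
move=> st tu; apply: tle_tlt; first exact: tle_trans st.2 tu.
exact: lt_le_trans (tlt_dom st) (tle_dom tu).
Qed.

Lemma tle_tlt_trans t s u : tle s t -> tlt t u -> tlt s u.
Proof.
move=> st tu; apply: tle_tlt; first exact: tle_trans st tu.2.
exact: le_lt_trans (tle_dom st) (tlt_dom tu).
Qed.

Lemma tau_nextP s t b : tle s t -> (tdom s < b <= tdom t)%O ->
  (tdom s <= tau_next s t b < b)%O /\
  forall a, (tdom s <= a < b)%O -> (teval t (tau_next s t b) <= teval t a)%N.
Proof.
move=> st /andP[sb _]; rewrite /tau_next; case: xgetP => [c _ []//|none].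
exfalso; suff H m a : teval t a = m -> ~ (tdom s <= a < b)%O.
  by apply: (H _ (tdom s) erefl); rewrite lexx.
elim/ltn_ind: m a => m IH a ma ab.
apply: (none a); split=> // c cb; rewrite leqNgt; apply/negP => ca.
by rewrite ma in ca; exact: IH ca c erefl cb.
Qed.

Lemma teval_inj t a b :
  (a < tdom t)%O -> (b < tdom t)%O -> teval t a = teval t b -> a = b.
Proof.
by move=> /tfun_Some ta /tfun_Some tb E; apply: tfun_inj tb; rewrite -E.
Qed.

Lemma tau_next_unique s t b c : tle s t -> (b <= tdom t)%O ->
  (tdom s <= c < b)%O ->
  (forall a, (tdom s <= a < b)%O -> (teval t c <= teval t a)%N) ->
  tau_next s t b = c.
Proof.
move=> st bt cb cmin; have sb : (tdom s < b <= tdom t)%O.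
  by rewrite bt andbT; case/andP: cb; exact: le_lt_trans.
have [nb nmin] := tau_nextP st sb.
apply: (@teval_inj t).
- by case/andP: nb => _ /lt_le_trans; exact.
- by case/andP: cb => _ /lt_le_trans; exact.
- by apply/eqP; rewrite eqn_leq nmin ?cmin.
Qed.

Lemma tau_next_stop s t : tau_next s t (tdom s) = tdom s.
Proof.
by rewrite /tau_next; case: xgetP => // c _ [/andP[/le_lt_trans h /h]];
  rewrite ltxx.
Qed.

(* The descent from b reaches tdom s at a first stage k. *)
Definition tau_reach s t b k := iter k (tau_next s t) b = tdom s /\
  forall j, (j < k)%N -> iter j (tau_next s t) b <> tdom s.

Lemma tau_reach_ex s t b : tle s t -> (tdom s <= b <= tdom t)%O ->
  exists k, tau_reach s t b k.
Proof.
move=> st; elim/omega1_ind: b => b IH /andP[sb bt].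
have [E|nE] := pselect (b = tdom s); first by exists 0%N; rewrite /tau_reach /= E.
have sb' : (tdom s < b <= tdom t)%O.
  by rewrite bt andbT lt_neqAle sb andbT; apply/eqP => /esym.
have [/andP[sn nb] _] := tau_nextP st sb'.
have [||k [kE kmin]] := IH (tau_next s t b) => //.
  by rewrite sn (le_trans (ltW nb)).
exists k.+1; split; first by rewrite iterSr.
by move=> [_//|j]; rewrite ltnS iterSr => /kmin.
Qed.

Lemma tau_reach_unique s t b k k' : tau_reach s t b k -> tau_reach s t b k' -> k = k'.
Proof.
move=> [kE kmin] [k'E k'min]; case: (ltngtP k k') => // [kk'|k'k].
- by case: (k'min _ kk').
- by case: (kmin _ k'k).
Qed.

Lemma tau_stageP s t : tle s t ->
  tau_beta s t (tau_stage s t) = tdom s /\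
  forall j, (j < tau_stage s t)%N -> tau_beta s t j <> tdom s.
Proof.
move=> st; have := @tau_reach_ex s t (tdom t) st.
by rewrite (tle_dom st) lexx => /(_ isT); exact: xgetPex.
Qed.

(* The sequence beta_0 > ... > beta_k, with k = tau_stage s t, is the one
   produced by the minimality rule. *)
Lemma tau_betaP s t i : tle s t -> (i < tau_stage s t)%N ->
  (tdom s <= tau_beta s t i.+1 < tau_beta s t i)%O /\
  forall a, (tdom s <= a < tau_beta s t i)%O ->
    (teval t (tau_beta s t i.+1) <= teval t a)%N.
Proof.
move=> st ik; apply: tau_nextP => //; have [_ +] := tau_stageP st.
elim: i ik => [|i IH] ik stage_min.
  rewrite lexx andbT lt_neqAle tle_dom // andbT; apply/eqP=> E.
  exact: stage_min ik (esym E).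
have [/andP[sn nb] _] := tau_nextP st (IH (ltnW ik) stage_min).
have /andP[_ bt] := IH (ltnW ik) stage_min.
rewrite (le_trans (ltW nb) bt) andbT lt_neqAle sn andbT; apply/eqP=> E.
exact: stage_min ik (esym E).
Qed.

Lemma tau_stage_eq s t k : tle s t ->
  tau_beta s t k = tdom s -> (forall j, (j < k)%N -> tau_beta s t j <> tdom s) ->
  tau_stage s t = k.
Proof.
move=> st kE kmin; apply: (@tau_reach_unique s t (tdom t)) => //.
exact: tau_stageP.
Qed.

Lemma tau_tt t : tau t t = [::].
Proof. by rewrite /tau (@tau_stage_eq _ _ 0). Qed.

(* Additivity of the length below a point whose values, near the top, exceed
   those used by tau(u, t). *)
Lemma tau_len_cat s u t : tle s u -> tle u t ->
  (forall i a, (i < tau_stage u t)%N -> (tdom s <= a < tdom u)%O ->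
     (teval t (tau_beta u t i.+1) <= teval t a)%N) ->
  tau_len s t = (tau_len u t + tau_len s u)%N.
Proof.
move=> su ut small; have st := tle_trans su ut.
have same i : (i <= tau_stage u t)%N -> tau_beta s t i = tau_beta u t i.
  elim: i => [//|i IH] ik; rewrite {1}/tau_beta iterS -/(tau_beta s t i).
  rewrite IH 1?ltnW //; have [/andP[sn nb] nmin] := tau_betaP ut ik.
  have bt : (tau_beta u t i <= tdom t)%O.
    clear -ik ut; elim: i ik => [//|i IH] ik.
    have [/andP[_ /ltW/le_trans h] _] := tau_betaP ut (ltnW ik).
    exact: h (IH (ltnW ik)).
  apply: tau_next_unique => //; first by rewrite (le_trans (tle_dom su)).
  move=> a /andP[sa ab]; have [ua|au] := leP (tdom u) a.
    by apply: nmin; rewrite ua.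
  by apply: small; rewrite ?sa.
have [uk _] := tau_stageP ut; have [sk skmin] := tau_stageP su.
have low i : tau_beta s t (i + tau_stage u t) = tau_beta s u i /\
    (tdom s <= tau_beta s u i <= tdom u)%O.
  elim: i => [|i [IH /andP[sb bu]]].
    by rewrite add0n same // uk /= lexx tle_dom.
  rewrite addSn {1}/tau_beta iterS -/(tau_beta _ _ _) IH.
  have [E|nE] := pselect (tau_beta s u i = tdom s).
    rewrite /tau_beta iterS -/(tau_beta s u i) E !tau_next_stop lexx.
    by rewrite tle_dom.
  have sb' : (tdom s < tau_beta s u i <= tdom u)%O.
    by rewrite bu andbT lt_neqAle sb andbT; apply/eqP => /esym.
  have [nb nmin] := tau_nextP su sb'; have /andP[sn nb'] := nb; split; last first.
    by rewrite sn (le_trans (ltW nb')).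
  apply: tau_next_unique => //; first exact: le_trans (tle_dom ut).
  move=> a ab; have /andP[_ ab'] := ab.
  by rewrite -!(tle_val ut) ?(lt_le_trans _ bu) //; exact: nmin.
rewrite !tau_lenE addnC; apply: tau_stage_eq => //; first by rewrite (low _).1.
move=> j jk; have [uj|ju] := leqP (tau_stage u t) j.
  rewrite -(subnK uj) (low _).1; apply: skmin.
  by rewrite -(ltn_add2r (tau_stage u t)) subnK.
rewrite same 1?ltnW // => E; have [/andP[un nb] _] := tau_betaP ut ju.
by have := le_lt_trans un nb; rewrite E ltNge tle_dom.
Qed.

Lemma tlt_restrict (t : Lambda) a :
  (a < tdom t)%O -> exists r, tlt r t /\ tdom r = a.
Proof.
move=> at_; pose f b := if (b < a)%O then tfun t b else None.
have fdom b : f b != None <-> (b < a)%O.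
  rewrite /f; case: ifP => // ba; split=> // _.
  by apply/tfun_dom; exact: lt_trans at_.
have ft b n : f b = Some n -> tfun t b = Some n by rewrite /f; case: ifP.
have finj b c n : f b = Some n -> f c = Some n -> b = c.
  by move=> /ft + /ft; exact: tfun_inj.
have finf : infinite_set [set n | forall b, f b <> Some n].
  move=> fin; apply: (@tfun_coinf t); apply: sub_finite_set fin.
  by move=> n /= nt b /ft; exact: nt.
by exists (MkLambda fdom finj finf); split=> //; apply: tle_tlt.
Qed.

Lemma tlt0_max q q' u : tlt0 q u -> tlt0 q' u ->
  exists2 q'', tlt0 q'' u &
    forall s, tle s u -> tlt0 q'' s -> tlt0 q s /\ tlt0 q' s.
Proof.
case: q q' => [q|] [q'|] /= qu q'u; last by exists None.
- have [qq'|q'q] := leP (tdom q) (tdom q').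
    exists (Some q') => //= s su q's; split=> //.
    exact: tle_tlt_trans (tle_cmp qu.2 q'u.2 qq') q's.
  exists (Some q) => //= s su qs; split=> //.
  exact: tle_tlt_trans (tle_cmp q'u.2 qu.2 (ltW q'q)) qs.
- by exists (Some q).
- by exists (Some q').
Qed.

(* Since u is injective, its values are large close to the top. *)
Lemma tint_large u N : exists2 q, tlt0 q u &
  forall s a, tint q u s -> (tdom s <= a < tdom u)%O -> (N <= teval u a)%N.
Proof.
elim: N => [|N [q qu qN]]; first by exists None.
have [[a [au aN]]|none] := pselect (exists a, (a < tdom u)%O /\ teval u a = N).
  have [r [ru ra]] := tlt_restrict au.
  have [q' q'u qP] := @tlt0_max q (Some r) u qu ru.
  exists q' => // s b [q's su] sbu; have [qs /tlt_dom rs] := qP _ su q's.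
  have := qN s b (conj qs su) sbu; rewrite leq_eqVlt => /orP[/eqP E|//].
  have /andP[sb bu] := sbu; have ba : b = a by apply: (teval_inj bu au); rewrite aN.
  by have := lt_le_trans rs sb; rewrite ra ba ltxx.
exists q => // s a qs sau; have := qN s a qs sau.
rewrite leq_eqVlt => /orP[/eqP E|//]; case: none; exists a.
by split=> //; case/andP: sau.
Qed.

(* The Lambda-duplicate; [false] and [true] encode the signs 1 and -1. *)
Definition Duplicate : Type := (Lambda * bool)%type.

HB.instance Definition _ := Choice.on Duplicate.

Definition dsign (i : bool) : int := (-1) ^+ i.

Definition W (r : option Lambda) (t : Lambda) (i : bool) : set Duplicate :=
  [set p | tint r t p.1 /\ dsign p.2 = (-1) ^+ tau_len p.1 t * dsign i].

Definition W_basis : set (set Duplicate) :=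
  [set U | exists r t i, tlt0 r t /\ U = W r t i].

Lemma W_top r t i : tlt0 r t -> W r t i (t, i).
Proof. by move=> rt; split; [split | rewrite -[(t, i).1]/t /tau_len tau_tt mul1r]. Qed.

Lemma W_nbhs r t i p : W r t i p ->
  exists2 q, tlt0 q p.1 & W q p.1 p.2 `<=` W r t i.
Proof.
case: p => u j /= [[ru ut] /= uj].
pose N := (\sum_(k < tau_stage u t) teval t (tau_beta u t k.+1))%N.
have [q qu qN] := tint_large u N.
have [q' q'u q'P] := tlt0_max ru qu.
exists q' => // -[s l] [/= [q's su] sl]; have [rs qs] := q'P _ su q's.
split=> /=; first by split=> //; exact: tle_trans ut.
rewrite (@tau_len_cat s u t) //; last first.
  move=> k a ku sau; have /andP[_ au] := sau.
  rewrite -(tle_val ut au); apply: leq_trans (qN s a (conj qs su) sau).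
  by rewrite /N (bigD1 (Ordinal ku)) //= leq_addr.
by rewrite sl uj exprD mulrA (mulrC (_ ^+ tau_len u t)).
Qed.

Lemma W_basis_cover : \bigcup_(U in W_basis) id U = setT.
Proof.
apply/seteqP; split=> // -[t i] _; exists (W None t i); last exact: W_top.
by exists None, t, i.
Qed.

Lemma W_basis_join U V p : W_basis U -> W_basis V -> id U p -> id V p ->
  exists B, [/\ W_basis B, id B p & id B `<=` id U `&` id V].
Proof.
move=> [r [t [i [rt ->]]]] [r' [t' [i' [rt' ->]]]] /W_nbhs[q qp qW]
  /W_nbhs[q' q'p q'W].
have [m mp mP] := tlt0_max qp q'p; exists (W m p.1 p.2); split.
- by exists m, p.1, p.2.
- by case: p mp {qp q'p qW q'W mP} => u j; exact: W_top.
- move=> s [[ms sp] sj]; have [qs q's] := mP _ sp ms.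
  by split; [apply: qW | apply: q'W]; split.
Qed.

HB.instance Definition _ :=
  isBaseTopological.Build Duplicate W_basis_cover W_basis_join.

Lemma W_basisP : basis W_basis.
Proof.
split=> [U BU|p A].
  by exists [set U]; [move=> _ -> | rewrite bigcup_set1].
move=> [_ [[D DB <-] [V DV Vp] DA]]; exists V; first by split=> //; exact: DB.
by apply: subset_trans DA => x Vx; exists V.
Qed.

Section SupNorm.
Context {R : realType} {T : Type} {V : normedModType R}.
Implicit Types (A : set T) (f g : T -> V).

Definition supnorm A f : R := sup [set `|f x| | x in A].

Definition bounded_on A f := exists M, forall x, A x -> `|f x| <= M.

Lemma supnorm_ge A f x : bounded_on A f -> A x -> `|f x| <= supnorm A f.
Proof.
move=> [M fM] Ax; apply: ub_le_sup; last by exists x.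
by exists M => _ [y Ay <-]; exact: fM.
Qed.

Lemma supnorm_le A f M :
  0 <= M -> (forall x, A x -> `|f x| <= M) -> supnorm A f <= M.
Proof.
move=> M0 fM; have [->|/set0P [x Ax]] := eqVneq A set0.
  by rewrite /supnorm image_set0 sup0.
by apply: ge_sup; [exists `|f x|, x | move=> _ [y Ay <-]; exact: fM].
Qed.

Lemma supnorm_ge0 A f : bounded_on A f -> 0 <= supnorm A f.
Proof.
move=> fA; have [->|/set0P [x Ax]] := eqVneq A set0.
  by rewrite /supnorm image_set0 sup0.
by apply: le_trans (supnorm_ge fA Ax).
Qed.

Lemma supnormD A f g : bounded_on A f -> bounded_on A g ->
  supnorm A (f + g) <= supnorm A f + supnorm A g.
Proof.
move=> fA gA; apply: supnorm_le => [|x Ax].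
  by rewrite addr_ge0 // supnorm_ge0.
by rewrite (le_trans (ler_normD _ _)) // lerD // supnorm_ge.
Qed.

Lemma supnormZ_le A a f : bounded_on A f ->
  supnorm A (a *: f) <= `|a| * supnorm A f.
Proof.
move=> fA; apply: supnorm_le => [|x Ax]; first by rewrite mulr_ge0 // supnorm_ge0.
by rewrite [(a *: f) x]/(a *: f x) normrZ ler_wpM2l // supnorm_ge.
Qed.

Lemma supnormZ A a f : bounded_on A f ->
  supnorm A (a *: f) = `|a| * supnorm A f.
Proof.
move=> fA; apply/eqP; rewrite eq_le supnormZ_le //=.
have [->|a0] := eqVneq a 0.
  rewrite normr0 mul0r; apply: supnorm_ge0; exists 0 => x _.
  by rewrite [X in `|X|](_ : _ = 0) ?normr0 //; exact: scale0r.
rewrite -ler_pdivlMl ?normr_gt0 // -normfV -{1}(scalerK a0 f).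
apply: supnormZ_le; have [M fM] := fA; exists (`|a| * M) => x Ax.
by rewrite [(a *: f) x]/(a *: f x) normrZ ler_wpM2l // fM.
Qed.

End SupNorm.

(* C_0(X): f vanishes at infinity when every {|f| >= e}, e > 0, is compact. *)
Section C0.
Context (R : realType) (X : topologicalType).

Definition vanishes_at_infinity (f : X -> R^o) :=
  forall e, 0 < e -> compact [set x | e <= `|f x|].

Definition C0_pred : {pred X -> R^o} :=
  fun f => `[< continuous f /\ vanishes_at_infinity f >].

Record C0 : Type := MkC0 { C0_val :> X -> R^o; C0_valP : C0_val \in C0_pred }.

HB.instance Definition _ := [isSub of C0 for C0_val].
HB.instance Definition _ := [Choice of C0 by <:].

Lemma C0_submod_closed : submod_closed C0_pred.
Proof.
split.
  apply/asboolP; split=> [x|e e0]; first exact: cst_continuous.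
  rewrite (_ : mkset _ = set0); first exact: compact0.
  apply/seteqP; split=> // x /=.
  by rewrite [X in `|X|](_ : _ = 0) // normr0 leNgt e0.
move=> a f g /asboolP[fc fv] /asboolP[gc gv].
have afgc : continuous (a *: f + g).
  by move=> x; apply: cvgD; [apply: cvgZr; exact: fc | exact: gc].
apply/asboolP; split=> // e e0.
pose d := e / 2 / (`|a| + 1).
have a1 : 0 < `|a| + 1 by rewrite ltr_wpDl.
have d0 : 0 < d by rewrite !divr_gt0.
have e2 : 0 < e / 2 by rewrite divr_gt0.
apply: (@subclosed_compact _ _
  ([set x | d <= `|f x|] `|` [set x | e / 2 <= `|g x|])).
- rewrite (_ : mkset _ = (fun x => `|(a *: f + g) x|) @^-1` [set y | e <= y]) //.
  apply: closed_comp; last exact: closed_ge.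
  by move=> x _; apply: cvg_norm; exact: afgc.
- by apply: compactU; [exact: fv | exact: gv].
- move=> x /= ex; apply: contrapT => /not_orP[/negP + /negP].
  rewrite -!ltNge => fd gd; move: ex; rewrite leNgt => /negP; apply.
  rewrite (le_lt_trans (ler_normD _ _)) // [e]splitr ler_ltD //.
  rewrite [(a *: f) x]/(a *: f x) normrZ.
  apply: (@le_trans _ _ ((`|a| + 1) * d)); last by rewrite mulrC divfK ?gt_eqF.
  by rewrite ler_pM // ?(ltW fd) // lerDl.
Qed.

HB.instance Definition _ :=
  GRing.isSubmodClosed.Build R (X -> R^o) C0_pred C0_submod_closed.
HB.instance Definition _ := [SubChoice_isSubLmodule of C0 by <:].

Implicit Types f g : C0.

Lemma C0_continuous f : continuous f.
Proof. by case: f => f /= /asboolP[]. Qed.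

Lemma C0_vanishes f : vanishes_at_infinity f.
Proof. by case: f => f /= /asboolP[]. Qed.

Lemma C0_bounded f : bounded_on setT f.
Proof.
have := @C0_vanishes f 1 ltr01; set K := mkset _ => Kc.
have : compact ((fun x => `|f x|) @` K).
  apply: continuous_compact => //; apply: continuous_subspaceT => x.
  by apply: cvg_norm; exact: C0_continuous.
move=> /compact_bounded /pinfty_ex_gt0[M M0 MK]; exists (Num.max M 1) => x _.
have [fx1|] := leP 1 `|f x|; last by rewrite le_max orbC => /ltW ->.
rewrite le_max (le_trans _ (MK `|f x| _)) ?ler_norm //.
by exists x.
Qed.

Definition C0_norm f : R := supnorm setT f.

Lemma C0_ler_normD f g : C0_norm (f + g) <= C0_norm f + C0_norm g.
Proof. exact: supnormD (C0_bounded f) (C0_bounded g). Qed.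

Lemma C0_normZ (a : R) f : C0_norm (a *: f) = `|a| * C0_norm f.
Proof. exact: supnormZ (C0_bounded f). Qed.

Lemma C0_norm0_eq0 f : C0_norm f = 0 -> f = 0.
Proof.
move=> f0; apply/val_inj/funext => x; apply/eqP; rewrite -normr_le0 -f0.
exact: supnorm_ge (C0_bounded f) _.
Qed.

HB.instance Definition _ :=
  Lmodule_isNormed.Build R C0 C0_ler_normD C0_normZ C0_norm0_eq0.

Lemma C0_normE f : `|f| = sup (range (fun x => `|f x|)).
Proof. by []. Qed.

Lemma C0_norm_ge f x : `|f x| <= `|f|.
Proof. exact: supnorm_ge (C0_bounded f) _. Qed.

Lemma C0_norm_le f M : 0 <= M -> (forall x, `|f x| <= M) -> `|f| <= M.
Proof. by move=> M0 fM; apply: supnorm_le. Qed.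

Lemma C0_complete (F : set_system C0) : ProperFilter F -> cauchy F -> cvg F.
Proof.
move=> FF /cauchyP cF.
have {}cF e : 0 < e -> exists g : C0, F [set f : C0 | `|g - f| < e].
  by move=> /cF[g]; rewrite -ball_normE; exists g.
have lim x : exists l : R^o, (fun f : C0 => f x) @ F --> l.
  apply/cvg_ex; apply: R_complete; apply: cauchy_exP => e /cF[g gF].
  exists (g x); rewrite -ball_normE.
  apply: (@filterS _ F _ _ _ _ gF) => f /= gf.
  exact: le_lt_trans (C0_norm_ge (g - f) x) gf.
have {lim} [l lF] := choice lim.
have close e : 0 < e -> exists g : C0, F [set f : C0 | `|g - f| < e] /\
    forall x, `|g x - l x| <= e.
  move=> e0; have [g gF] := cF _ e0; exists g; split=> // x.
  have gl : (fun f : C0 => `|g x - f x|) @ F --> `|g x - l x|.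
    by apply: cvg_norm; apply: cvgB; [exact: cvg_cst | exact: lF].
  refine (@closed_cvg C0 R F _ (fun f : C0 => `|g x - f x|) (fun y => y <= e)
    (@closed_le _ e) _ _ gl).
  apply: (@filterS _ F _ _ _ _ gF) => f /= gf.
  exact: le_trans (C0_norm_ge (g - f) x) (ltW gf).
have lc : continuous l.
  move=> x; apply/cvgrPdist_le => e e0; have e3 : 0 < e / 3 by rewrite divr_gt0.
  have [g [_ gl]] := close _ e3.
  have /cvgrPdist_le/(_ _ e3) := @C0_continuous g x; apply: filterS => y gxy.
  rewrite (_ : l x - l y = (l x - g x) + (g x - g y) + (g y - l y)); last first.
    by rewrite !addrA !subrK.
  rewrite (le_trans (ler_normD _ _)) // (_ : e = e / 3 + e / 3 + e / 3); last by lra.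
  by rewrite lerD // (le_trans (ler_normD _ _)) // lerD // distrC.
have lP : l \in C0_pred.
  apply/asboolP; split=> // e e0.
  have e2 : 0 < e / 2 by rewrite divr_gt0.
  have [g [_ gl]] := close _ e2.
  apply: (@subclosed_compact _ _ [set x | e / 2 <= `|g x|]).
  - rewrite (_ : mkset _ = (fun x => `|l x|) @^-1` [set y | e <= y]) //.
    apply: closed_comp; last exact: closed_ge.
    by move=> x _; apply: cvg_norm; exact: lc.
  - exact: C0_vanishes.
  - move=> x /= ex; have := gl x; rewrite distrC => lgx.
    have := le_trans (lerB_dist (l x) (g x)) lgx; lra.
apply/cvg_ex; exists (MkC0 lP); apply/cvgrPdist_le => e e0.
have e2 : 0 < e / 2 by rewrite divr_gt0.
have [g [gF gl]] := close _ e2; apply: (@filterS _ F _ _ _ _ gF) => f /= gf.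
rewrite -(subrK g (MkC0 lP)) -addrA (le_trans (ler_normD _ _)) //.
rewrite [e]splitr lerD ?(ltW gf) // C0_norm_le ?(ltW e2) // => x.
by rewrite distrC; exact: gl.
Qed.

HB.instance Definition _ := Uniform_isComplete.Build C0 C0_complete.

End C0.

(* The normed space of continuous linear maps, with the operator norm. *)
Section ContinuousLinear.
Context (R : realType) (V W : normedModType R).

Definition clin_pred : {pred V -> W} :=
  fun f => `[< linear f /\ continuous f >].

Record clin : Type :=
  MkClin { clin_val :> V -> W; clin_valP : clin_val \in clin_pred }.

HB.instance Definition _ := [isSub of clin for clin_val].
HB.instance Definition _ := [Choice of clin by <:].

Lemma clin_submod_closed : submod_closed clin_pred.
Proof.
split.
  apply/asboolP; split=> [a x y|x]; last exact: cst_continuous.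
  by rewrite /= scaler0 addr0.
move=> a f g /asboolP[fl fc] /asboolP[gl gc]; apply/asboolP; split.
  move=> b x y.
  change (a *: f (b *: x + y) + g (b *: x + y) =
    b *: (a *: f x + g x) + (a *: f y + g y)).
  by rewrite fl gl !scalerDr !scalerA addrACA [a * b]mulrC.
by move=> x; apply: cvgD; [apply: cvgZr; exact: fc | exact: gc].
Qed.

HB.instance Definition _ :=
  GRing.isSubmodClosed.Build R (V -> W) clin_pred clin_submod_closed.
HB.instance Definition _ := [SubChoice_isSubLmodule of clin by <:].

Implicit Types f g : clin.

Lemma clin_linear f : linear f.
Proof. by case: f => f /= /asboolP[]. Qed.

Lemma clin_continuous f : continuous f.
Proof. by case: f => f /= /asboolP[]. Qed.

Definition clin_lin f : {linear V -> W} :=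
  HB.pack (clin_val f) (GRing.isLinear.Build _ _ _ _ _ (clin_linear f)).

Definition unit_ball : set V := [set x | `|x| <= 1].

Lemma clin_bounded f : bounded_on unit_ball f.
Proof.
have /(linear_boundedP (clin_lin f)) : bounded_near (clin_lin f) (nbhs 0).
  by apply: continuous_linear_bounded; exact: clin_continuous.
move=> /pinfty_ex_gt0[M M0 fM]; exists M => x /= x1.
by rewrite (le_trans (fM x)) // ler_piMr // ltW.
Qed.

Definition clin_norm f : R := supnorm unit_ball f.

Lemma clin_ler_normD f g : clin_norm (f + g) <= clin_norm f + clin_norm g.
Proof. exact: supnormD (clin_bounded f) (clin_bounded g). Qed.

Lemma clin_normZ (a : R) f : clin_norm (a *: f) = `|a| * clin_norm f.
Proof. exact: supnormZ (clin_bounded f). Qed.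

Lemma clin_norm0_eq0 f : clin_norm f = 0 -> f = 0.
Proof.
move=> f0; suff fx0 x : f x = 0 by apply/val_inj/funext => x; exact: fx0.
have [->|x0] := eqVneq x 0; first exact: (linear0 (clin_lin f)).
have nx0 : `|x| != 0 by rewrite normr_eq0.
have fZ : f (`|x|^-1 *: x) = `|x|^-1 *: f x := linearZZ (clin_lin f) _ _.
have : `|f (`|x|^-1 *: x)| <= 0.
  rewrite -f0; apply: (supnorm_ge (clin_bounded f)).
  by rewrite /unit_ball /= normrZ normfV normr_id mulVf.
by rewrite normr_le0 fZ scaler_eq0 invr_eq0 (negbTE nx0) => /eqP.
Qed.

HB.instance Definition _ :=
  Lmodule_isNormed.Build R clin clin_ler_normD clin_normZ clin_norm0_eq0.

Lemma clin_normE f : `|f| = sup [set `|f x| | x in [set x | `|x| <= 1]].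
Proof. by []. Qed.

End ContinuousLinear.

(* n-fold Frechet differentiability on all of V: the derivative is a map into
   the space of continuous linear maps, which is differentiated again. *)
Fixpoint frechet_differentiable (R : realType) (V : normedModType R) (n : nat)
    (W : normedModType R) (f : V -> W) : Prop :=
  if n is n'.+1 then
    exists2 Df : V -> clin V W, (forall x, is_diff x f (Df x)) &
      frechet_differentiable n' Df
  else True.

Definition smooth (R : realType) (V W : normedModType R) (f : V -> W) : Prop :=
  forall n, frechet_differentiable n f.

Definition smooth_bump (R : realType) (V : normedModType R) (phi : V -> R^o) :=
  [/\ exists x, phi x != 0, smooth phi &
      exists2 B : set V, bounded_set B & forall x, ~ B x -> phi x = 0].

(* Main.v *)
Require Import Defs.
From HB Require Import structures.
From mathcomp Require Import all_boot all_order all_algebra.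
From mathcomp Require Import finmap.
From mathcomp Require Import all_classical all_reals all_analysis.
From mathcomp Require Import ring lra.

Import Order.TTheory GRing.Theory Num.Theory.
Import numFieldNormedType.Exports.
Local Open Scope classical_set_scope.
Local Open Scope ring_scope.

Set Implicit Arguments.
Unset Strict Implicit.
Unset Printing Implicit Defensive.

(** The bump is an infinite product over the points p of the duplicate D,
    [bump f = prod_p (1 - peak p f)] inside the open unit ball and 0 outside,
    in which near every f only finitely many factors matter.  The number
    [peak p f] tests whether the value of f^2 at p, on its way up to 1, stands
    out against the values at the immediate successors of p in the tree, taken
    with both signs ([succs p]).  It vanishes when some successor q satisfies
    1 - f(q)^2 <= 2 (1 - f(p)^2), and it is 1 when f(p)^2 >= 15/16 and,
    for all successors q, f(q)^2 < 1 and 4 (1 - f(p)^2) <= 1 - f(q)^2.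

    The tree enters through two facts.

    (1) Each point x has basic neighbourhoods W(r, x), which map bijectively
    onto the tree intervals (r, x].  For p <> x in W(r, x), the first step from
    p towards x stays in W(r, x), so a continuous function takes nearly the
    same value there as at p if W(r, x) is small.  So the points where f^2
    falls by at least a fixed d at every successor form a discrete set, which
    meets the compact set where f^2 >= e in a finite set ([drop_discrete],
    [drop_finite]).  If |f| < 1 everywhere, then 1 - f^2 >= c for some c > 0,
    and for g close to f, at every point p outside of such a finite set,
    either g(p)^2 <= 7/8 or g(q)^2 falls short of g(p)^2 at some successor q
    by less than 1 - g(p)^2; in both cases [peak p g] vanishes ([peak_near]).

    (2) If |f| >= 1 somewhere, then the compact set where |f| >= 1 has a point
    p that is maximal in the tree ([compact_tree_maximal]).  There
    |f(q)| < 1 for all successors q, uniformly, so [peak p g = 1] for all g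
    close to f, and the product vanishes near f ([bump_near_out]).

    Hence near every f the function [bump] is built from finitely many
    evaluations by algebraic operations and the function x |-> exp(-1/x);
    such functions are smooth ([locally_elementary_smooth]). *)

(** * A flat function on the real line *)

Section Flat.
Context {R : realType}.

(** The derivatives of exp (- 1 / x), extended by 0, are linear combinations
    of members of this family. *)
Definition flat (n : nat) (x : R) : R :=
  if 0 < x then x^-1 ^+ n * expR (- x^-1) else 0.

Lemma flat_gt0 n x : 0 < x -> 0 < flat n x.
Proof. by move=> x0; rewrite /flat x0 mulr_gt0 ?exprn_gt0 ?invr_gt0 ?expR_gt0. Qed.

Lemma flat_le0 n x : x <= 0 -> flat n x = 0.
Proof. by move=> x0; rewrite /flat ltNge x0. Qed.

Lemma flat_ge0 n x : 0 <= flat n x.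
Proof. by have [/flat_le0->|/(flat_gt0 n)/ltW] := leP x 0. Qed.

(** Raise expR (1 / (x k)) >= 1 / (x k) to the power k = n + 2.  The quadratic
    bound gives the derivative 0 at the origin. *)
Lemma flat_le n x : 0 <= x -> flat n x <= n.+2%:R ^+ n.+2 * x ^+ 2.
Proof.
rewrite le_eqVlt => /predU1P[<-|x0].
  by rewrite flat_le0 // expr0n mulr0.
rewrite /flat x0 expRN.
have k0 : 0 < n.+2%:R :> R by [].
have xi : 0 < x^-1 by rewrite invr_gt0.
have lb : (x^-1 / n.+2%:R) ^+ n.+2 <= expR x^-1.
  have -> : expR x^-1 = expR (x^-1 / n.+2%:R) ^+ n.+2.
    by rewrite -expRM_natr divfK // gt_eqF.
  rewrite lerXn2r ?nnegrE ?divr_ge0 ?expR_ge0 ?(ltW xi) //.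
  by rewrite (le_trans _ (expR_ge1Dx _)) // lerDr.
rewrite ler_pdivrMr ?expR_gt0 //; apply: le_trans (ler_wpM2l _ lb); last first.
  by rewrite mulr_ge0 // exprn_ge0 // ltW.
have kk : n.+2%:R ^+ n.+2 * n.+2%:R^-1 ^+ n.+2 = 1 :> R.
  by rewrite -exprMn divff ?gt_eqF // expr1n.
have xx : x ^+ 2 * x^-1 ^+ 2 = 1 by rewrite -exprMn divff ?gt_eqF // expr1n.
rewrite exprMn (_ : x^-1 ^+ n.+2 = x^-1 ^+ n * x^-1 ^+ 2); last first.
  by rewrite -exprD addn2.
rewrite [leRHS](_ : _ = x^-1 ^+ n * (n.+2%:R ^+ n.+2 * n.+2%:R^-1 ^+ n.+2) *
  (x ^+ 2 * x^-1 ^+ 2)); last by ring.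
by rewrite kk xx !mulr1.
Qed.

Lemma is_derive_flat n (x : R) :
  is_derive x (1 : R) (flat n) (flat n.+2 x - n%:R * flat n.+1 x).
Proof.
have [x0|x0|->] := ltgtP x 0.
- rewrite !flat_le0 ?(ltW x0) // mulr0 subr0.
  apply: (near_eq_is_derive _ (f := cst 0)) => //.
  near=> y; rewrite /cst flat_le0 //; apply: ltW.
  by near: y; exact: lt_nbhsl.
- have /near_eq_is_derive : \forall y \near x,
      (y : R)^-1 ^+ n * expR (- y^-1) = flat n y.
    near=> y; rewrite /flat ifT //; near: y; exact: lt_nbhsr.
  apply; have xn0 : x != 0 by rewrite gt_eqF.
  have dV : is_derive x (1:R) (@GRing.inv R) (- x ^- 2).
    apply: DeriveDef; first exact: (@derivableV _ _ id).
    by rewrite (@deriveV _ _ id) // derive_id [LHS]mulr1.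
  have dE : is_derive x (1:R) (fun y : R => expR (- y^-1)) (x ^- 2 * expR (- x^-1)).
    have := @is_derive1_comp _ expR (- @GRing.inv R) x _ _
      (is_derive_expR (- x^-1)) (is_deriveN dV).
    by rewrite opprK mulrC.
  rewrite (_ : (fun _ => _) = (@GRing.inv R ^+ n) * (fun y => expR (- y^-1)));
    last by apply/funext => y; rewrite -[RHS]/(_ y * _ y) exprfctE.
  apply: (is_derive_eq (is_deriveM (is_deriveX n dV) dE)).
  rewrite exprfctE.
  rewrite /flat x0 -![_ *: _]/(_ * _) /= -exprVn.
  by case: n => [|n]; rewrite ?mul0r ?mulr0 /= !exprS; ring.
- rewrite !flat_le0 // mulr0 subr0.
  set C : R := n.+2%:R ^+ n.+2.
  have C0 : 0 < C by rewrite exprn_gt0.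
  have lim : (fun h : R => h^-1 *: ((flat n \o shift 0) (h *: 1) - flat n 0))
      @ 0^' --> 0.
    apply/cvgr0Pnorm_le => e e0; near=> h.
    rewrite /= addr0 [h *: 1]mulr1 [flat n 0]flat_le0 // subr0 [_ *: _]/(_ * _).
    have h0 : h != 0 by near: h; exact: nbhs_dnbhs_neq.
    rewrite normrM normfV ler_pdivrMl ?normr_gt0 // ger0_norm ?flat_ge0 //.
    have [hl|hg] := leP h 0; first by rewrite flat_le0 // mulr_ge0 // ltW.
    rewrite (le_trans (flat_le n (ltW hg))) // -/C gtr0_norm // expr2 mulrCA.
    rewrite ler_wpM2l ?(ltW hg) // -ler_pdivlMl //.
    rewrite -(gtr0_norm hg); near: h.
    by apply: dnbhs0_le; rewrite mulr_gt0 ?invr_gt0.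
  apply: DeriveDef; first by apply/cvg_ex; exists 0.
  exact: cvg_lim lim.
Unshelve. all: by end_near.
Qed.
End Flat.

(** * Locally elementary functions are smooth *)

Section Elementary.
Context {R : realType} {V : normedModType R}.

(** The functions that are obtained from continuous linear functionals by
    the operations needed below.  The set U, on which denominators do not
    vanish, is where the function counts; its values elsewhere are arbitrary
    by [elementary_eq]. *)
Inductive elementary (U : set V) : (V -> R) -> Prop :=
| elementary_clin (l : clin V R^o) : elementary U l
| elementary_cst c : elementary U (fun _ => c)
| elementaryD f g : elementary U f -> elementary U g ->
    elementary U (fun x => f x + g x)
| elementaryM f g : elementary U f -> elementary U g ->
    elementary U (fun x => f x * g x)
| elementaryV f : (forall x, U x -> f x != 0) -> elementary U f ->
    elementary U (fun x => (f x)^-1)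
| elementary_flat n f : elementary U f -> elementary U (fun x => flat n (f x))
| elementary_eq f g : (forall x, U x -> f x = g x) ->
    elementary U f -> elementary U g.

(** Finite sums of vectors with elementary coefficients.  Unlike the scalar
    class, this one contains the derivatives of its members, as the target
    space is arbitrary. *)
Inductive elementary_map (U : set V) (W : normedModType R) : (V -> W) -> Prop :=
| elementary_map0 : elementary_map U (fun _ => 0)
| elementary_mapD f F (w : W) : elementary U f -> elementary_map U F ->
    elementary_map U (fun x => f x *: w + F x).

Lemma elementary_map_add U (W : normedModType R) (F G : V -> W) :
  elementary_map U F -> elementary_map U G ->
  elementary_map U (fun x => F x + G x).
Proof.
move=> + UG; elim=> [|f F' w Uf _ UFG].
  by under eq_fun do rewrite add0r.
by under eq_fun do rewrite -addrA; exact: elementary_mapD.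
Qed.

Lemma elementary_map_scale U (W : normedModType R) (f : V -> R) (F : V -> W) :
  elementary U f -> elementary_map U F -> elementary_map U (fun x => f x *: F x).
Proof.
move=> Uf; elim=> [|g F' w Ug _ UfF].
  by under eq_fun do rewrite scaler0; exact: elementary_map0.
under eq_fun do rewrite scalerDr scalerA.
by apply: elementary_mapD => //; exact: elementaryM.
Qed.

Lemma elementary_map_linear U (W W' : normedModType R) (T : {linear W -> W'})
    (F : V -> W) :
  elementary_map U F -> elementary_map U (fun x => T (F x)).
Proof.
elim=> [|f F' w Uf _ UTF]; last first.
  by under eq_fun do rewrite linearD linearZ; exact: elementary_mapD.
by under eq_fun do rewrite linear0; exact: elementary_map0.
Qed.

Lemma is_diff_near_eq (W : normedModType R) (f g df : V -> W) x :
  (\forall y \near x, f y = g y) -> is_diff x f df -> is_diff x g df.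
Proof.
move=> fg [fd <-]; have [dc fE] := (diff_locallyP x f).1 fd.
have gE : g \o shift x = cst (g x) + 'd f x +o_ 0 id.
  apply/eqaddoP => e e0; move/eqaddoP: fE => /(_ e e0).
  have : \forall h \near (0 : V), f (h + x) = g (h + x).
    by move: fg; rewrite (near_shift 0) /= subr0.
  apply: filterS2 => h fgh.
  by rewrite -[(g \o _ - _) h]/(g (h + x) - (g x + 'd f x h))
    -[(f \o _ - _) h]/(f (h + x) - (f x + 'd f x h)) fgh (nbhs_singleton fg).
have dE := diff_unique dc gE.
by apply: DiffDef => //; apply/diff_locallyP; rewrite dE.
Qed.

Lemma elementary_diff U f : open U -> elementary U f ->
  exists2 Df : V -> clin V R^o, elementary_map U Df &
    forall x, U x -> is_diff x (f : V -> R^o) (Df x).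
Proof.
move=> oU; elim=> {f}.
- move=> l; exists (fun _ => l).
    rewrite (_ : (fun _ => l) = fun _ => 1 *: l + 0); last first.
      by apply/funext => x; rewrite scale1r addr0.
    apply: (elementary_mapD (f := fun _ => 1) (F := fun _ => 0)).
      exact: elementary_cst.
    exact: elementary_map0.
  move=> x _; apply: DiffDef.
    exact: (@linear_differentiable _ _ _ (clin_lin l) x (@clin_continuous _ _ _ l)).
  exact: (@diff_lin _ _ _ (clin_lin l) x (@clin_continuous _ _ _ l)).
- move=> c; exists (fun _ => 0); first exact: elementary_map0.
  by move=> x _; exact: is_diff_cst.
- move=> f g _ [Df UDf fD] _ [Dg UDg gD].
  exists (fun x => Df x + Dg x); first exact: elementary_map_add.
  by move=> x Ux; exact: is_diffD (fD x Ux) (gD x Ux).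
- move=> f g Uf [Df UDf fD] Ug [Dg UDg gD].
  exists (fun x => f x *: Dg x + g x *: Df x).
    by apply: elementary_map_add; exact: elementary_map_scale.
  by move=> x Ux; exact: is_diffM (fD x Ux) (gD x Ux).
- move=> f f0 Uf [Df UDf fD].
  exists (fun x => - (f x)^-1 ^+ 2 *: Df x).
    apply: elementary_map_scale => //.
    rewrite (_ : (fun _ => _) = fun x => (-1) * ((f x)^-1 * (f x)^-1)); last first.
      by apply/funext => x; rewrite mulN1r expr2.
    apply: elementaryM; first exact: elementary_cst.
    by apply: elementaryM; exact: elementaryV.
  move=> x Ux; have [fd fE] := fD x Ux; apply: DiffDef.
    exact: differentiableV fd (f0 x Ux).
  by rewrite (diffV fd (f0 x Ux)) fE exprVn.
- move=> n f Uf [Df UDf fD].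
  exists (fun x => (flat n.+2 (f x) - n%:R * flat n.+1 (f x)) *: Df x).
    apply: elementary_map_scale => //.
    rewrite (_ : (fun _ => _) =
      fun x => flat n.+2 (f x) + (- n%:R) * flat n.+1 (f x)); last first.
      by apply/funext => x; rewrite mulNr.
    apply: elementaryD; first exact: elementary_flat.
    by apply: elementaryM; [exact: elementary_cst|exact: elementary_flat].
  move=> x Ux; have [fd fE] := is_derive_flat n (f x).
  have fl : differentiable (flat n) (f x) by apply/derivable1_diffP.
  have := @is_diff_comp _ _ _ _ _ _ _ _ _ (fD x Ux) (differentiableP fl).
  move/is_diff_eq; apply; apply/funext => h /=.
  by rewrite diff1E //= derive1E fE [LHS]mulrC.
- move=> f g fg _ [Df UDf fD]; exists Df => // x Ux.
  apply: is_diff_near_eq (fD x Ux).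
  by apply: filterS (open_nbhs_nbhs (conj oU Ux)) => y /fg.
Qed.

(** The rank-one operators, through which a constant vector w contributes to
    the derivative of f(x) w. *)
Section Tensor.
Context (W : normedModType R) (w : W).

Lemma tensor_subproof (l : clin V R^o) :
  (fun x => l x *: w) \in clin_pred (V := V) (W := W).
Proof.
apply/asboolP; split=> [a x y|x].
  by rewrite clin_linear scalerDl -scalerA.
by apply: cvgZl; exact: clin_continuous.
Qed.

Definition tensor (l : clin V R^o) : clin V W := MkClin (tensor_subproof l).

Lemma tensor_linear : linear tensor.
Proof.
move=> a l m; apply/val_inj/funext => x.
by rewrite [LHS]scalerDl -scalerA.
Qed.

HB.instance Definition _ :=
  GRing.isLinear.Build R (clin V R^o) (clin V W) _ tensor tensor_linear.

End Tensor.

Lemma elementary_map_diff U (W : normedModType R) (F : V -> W) :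
  open U -> elementary_map U F ->
  exists2 DF : V -> clin V W, elementary_map U DF &
    forall x, U x -> is_diff x F (DF x).
Proof.
move=> oU; elim=> {F} [|f F w Uf UF [DF UDF FD]].
  exists (fun _ => 0); first exact: elementary_map0.
  by move=> x _; exact: is_diff_cst.
have [Df UDf fD] := elementary_diff oU Uf.
exists (fun x => tensor w (Df x) + DF x).
  by apply: elementary_map_add => //; exact: elementary_map_linear.
move=> x Ux; have [fd fE] := fD x Ux.
apply: (@is_diffD _ _ _ (fun x => f x *: w)); last exact: FD.
apply: DiffDef; first exact: differentiableZl.
by rewrite diffZl //; apply/funext => h; rewrite fE.
Qed.

Definition locally_elementary (W : normedModType R) (F : V -> W) :=
  forall x, exists U G, [/\ open U, U x, elementary_map U G &
    forall y, U y -> F y = G y].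

(** The derivative is determined by the germ of F, so it is again locally
    elementary, and the induction on the order goes through. *)
Lemma locally_elementary_smooth (W : normedModType R) (F : V -> W) :
  locally_elementary F -> smooth F.
Proof.
move=> + n; elim: n W F => [//|n IH] W F FE.
have /choice [DF FD] : forall x, exists L : clin V W, is_diff x F L.
  move=> x; have [U [G [oU Ux UG FG]]] := FE x.
  have [DG _ GD] := elementary_map_diff oU UG; exists (DG x).
  apply: is_diff_near_eq (GD x Ux).
  by apply: filterS (open_nbhs_nbhs (conj oU Ux)) => y /FG.
exists DF => //; apply: IH => x; have [U [G [oU Ux UG FG]]] := FE x.
have [DG UDG GD] := elementary_map_diff oU UG.
exists U, DG; split=> // y Uy; apply/val_inj.
rewrite /= -(@diff_val _ _ _ _ _ _ _ (FD y)).
apply: (@diff_val _ _ _ _ _ _ _ (is_diff_near_eq _ (GD y Uy))).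
by apply: filterS (open_nbhs_nbhs (conj oU Uy)) => z /FG.
Qed.

End Elementary.

(** * Compactness in the duplicate *)

Definition covers (t u : Lambda) : Prop :=
  tlt t u /\ forall v, tlt t v -> tle v u -> v = u.

(** Taking both points over each successor avoids tracking which of them shares
    small neighbourhoods W(r, x) with p. *)
Definition succs (p : Duplicate) : set Duplicate := [set q | covers p.1 q.1].

(** The successor is the restriction of s to the least ordinal above the
    domain of t. *)
Lemma covers_between t s : tlt t s -> exists2 u, covers t u & tle u s.
Proof.
move=> ts; have [|b tb bmin] := @omega1_wo [set a | (tdom t < a)%O].
  by exists (tdom s); exact: tlt_dom.
have [u us ub] : exists2 u, tle u s & tdom u = b.
  have := bmin _ (tlt_dom ts); rewrite le_eqVlt => /predU1P[->|bs]; first by exists s.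
  by have [u [[_ us] ub]] := tlt_restrict bs; exists u.
exists u => //; split=> [|v tv vu].
  by apply: tle_tlt; [apply: (tle_cmp ts.2 us); rewrite ub ltW | rewrite ub].
apply: tle_anti vu (tle_cmp us (tle_trans vu us) _).
by rewrite ub; apply: bmin; exact: tlt_dom.
Qed.

Lemma covers_inj t u u' s :
  covers t u -> covers t u' -> tle u s -> tle u' s -> u = u'.
Proof.
move=> [tu umin] [tu' umin'] us us'.
have [uu'|/ltW u'u] := leP (tdom u) (tdom u').
  by apply: umin' => //; exact: tle_cmp us us' uu'.
by apply/esym/umin => //; exact: tle_cmp us' us u'u.
Qed.

Lemma nbhs_W r t i : tlt0 r t -> nbhs ((t, i) : Duplicate) (W r t i).
Proof.
move=> rt; apply: open_nbhs_nbhs; split; last exact: W_top.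
by apply: W_basisP.1; exists r, t, i.
Qed.

Lemma nbhs_sub_W (x : Duplicate) (N : set Duplicate) :
  nbhs x N -> exists2 r, tlt0 r x.1 & W r x.1 x.2 `<=` N.
Proof.
move=> /(W_basisP.2 x)[U /= [[r [t [i [rt ->]]]]] /W_nbhs[q qx qW] WN].
by exists q => // y /qW/WN.
Qed.

Lemma W_sign_inj r t i p q : W r t i p -> W r t i q -> p.1 = q.1 -> p = q.
Proof.
move: p q => [s j] [s' j'] [_ /= sj] [_ /= sj'] ss'; rewrite ss' in sj *.
by congr pair; apply: (@signr_inj int); rewrite -/(dsign j) sj -sj'.
Qed.

Lemma W_sign_ex r t i s : tint r t s -> exists j, W r t i (s, j).
Proof.
move=> rst; exists (odd (tau_len s t) (+) i); split=> //=.
by rewrite /dsign signr_addb signr_odd.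
Qed.

Section Compact.
Context {T : topologicalType}.

(** Otherwise the cofinite subsets of K `&` P generate a proper filter, and a
    cluster point x of it in K would have every neighbourhood meet P outside
    of x. *)
Lemma compact_discrete_finite (K P : set T) : compact K ->
  (forall x, K x -> exists2 N, nbhs x N & N `&` P `<=` [set x]) ->
  finite_set (K `&` P).
Proof.
move=> Kc KP; apply: contrapT => inf.
pose F : set_system T := fun B => finite_set ((K `&` P) `\` B).
have FF : ProperFilter F.
  split; first by move=> F0; apply: inf; move: F0; rewrite /F setD0.
  split.
  - by rewrite /F setDT.
  - by move=> A B FA FB; rewrite /F setDIr finite_setU.
  - by move=> A B AB; apply: sub_finite_set; exact: setDS.
have FKP : F (K `&` P) by rewrite /F setDv.
have [|x [Kx xF]] := Kc F FF; first by apply: filterS FKP => x [].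
have [N xN NP] := KP x Kx.
have FX : F ((K `&` P) `\ x).
  by apply: (@sub_finite_set _ _ [set x]) (finite_set1 x) => y [KPy]
    /not_andP[|/contrapT].
have [y [[KPy yx] Ny]] := xF _ _ FX xN.
by apply: yx; apply: NP; split=> //; case: KPy.
Qed.

End Compact.

(** The height is upper semicontinuous, since the points of W(r, x) lie below
    x; so it attains its maximum on K, and any point of maximal height will
    do. *)
Lemma compact_tree_maximal (K : set Duplicate) : compact K -> K !=set0 ->
  exists2 p, K p & forall q, tlt p.1 q.1 -> ~ K q.
Proof.
move=> Kc [p0 Kp0].
pose F := filter_from K (fun p => [set q | K q /\ (tdom p.1 <= tdom q.1)%O]).
have FF : ProperFilter F.
  apply: filter_from_proper; last by move=> p Kp; exists p; split; rewrite ?lexx.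
  apply: filter_from_filter; first by exists p0.
  move=> p q Kp Kq; have [pq|/ltW qp] := leP (tdom p.1) (tdom q.1).
    by exists q => // z [Kz qz]; do !split=> //; exact: le_trans qz.
  by exists p => // z [Kz pz]; do !split=> //; exact: le_trans pz.
have [|x [Kx xF]] := Kc F FF; first by exists p0 => // z [].
exists x => // q xq Kq.
have xW : nbhs x (W None x.1 x.2) by case: x {Kx xF xq} => t i; exact: nbhs_W.
have Fq : F [set z | K z /\ (tdom q.1 <= tdom z.1)%O] by exists q.
have [z [[Kz qz] [[_ zx] _]]] := xF _ _ Fq xW.
by have := le_lt_trans (le_trans qz (tle_dom zx)) (tlt_dom xq); rewrite ltxx.
Qed.

(** Below any given s there is at most one successor of the fixed point p. *)
Lemma succs_discrete p (x : Duplicate) :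
  exists2 N, nbhs x N & N `&` succs p `<=` [set x].
Proof.
case: x => s j; have [[u [pu us]]|none] := pselect (exists u, covers p.1 u /\ tlt u s).
  exists (W (Some u) s j) => [|[v i] [[[/= uv vs] _] pv]]; first exact: nbhs_W.
  have E := covers_inj pu pv us.2 vs.
  by case: uv => /(_ E).
exists (W None s j) => [|[v i] [Wv pv]]; first exact: nbhs_W.
apply: (W_sign_inj Wv (W_top _ _)) => //=; apply: contrapT => vs.
by apply: none; exists v; split=> //; split=> //; case: Wv => -[].
Qed.

(** If p <> x lies in a neighbourhood W(r, x) on which a varies by less than
    d, then so does the successor of p in the direction of x, with the right
    sign, and a does not drop by d there. *)
Lemma drop_discrete (R : realType) (a : Duplicate -> R) (d : R) (x : Duplicate) :
  {for x, continuous a} -> 0 < d ->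
  exists2 N, nbhs x N &
    N `&` [set p | forall q, succs p q -> a q <= a p - d] `<=` [set x].
Proof.
move=> ac d0; have d2 : 0 < d / 2 by rewrite divr_gt0.
have /nbhs_sub_W[r rx rN] : \forall y \near x, `|a x - a y| < d / 2.
  by move/cvgrPdist_lt : ac; exact.
case: x rx rN {ac} => s j /= rx rN.
exists (W r s j) => [|[t i] [Wt drop]]; first exact: nbhs_W.
apply: (W_sign_inj Wt (W_top _ _)) => //=; apply: contrapT => ts.
have [[/= rt tles] _] := Wt.
have tlts : tlt t s by [].
have [u tu us] := covers_between tlts.
have [|k Wu] := @W_sign_ex r s j u.
  split=> //; case: r rt {rx rN Wt} => //= r' rt.
  exact: tlt_tle_trans rt tu.1.2.
have := drop (u, k) tu; have := rN _ Wt; have := rN _ Wu.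
rewrite !ltr_norml => /andP[? ?] /andP[? ?] ?; lra.
Qed.

(** * A smooth step and products with finitely many relevant factors *)

Section Step.
Context {R : realType}.
Implicit Types x y : R.

(** For x > 0 this rises from 0 to 1 as y runs from 2 x to 4 x.  The
    denominator vanishes only where 4 x <= y <= 2 x, so the function is smooth
    wherever x > 0 or y > 0. *)
Definition step x y : R :=
  flat 0 (y - 2 * x) / (flat 0 (y - 2 * x) + flat 0 (4 * x - y)).

Lemma step0 x y : y <= 2 * x -> step x y = 0.
Proof. by move=> yx; rewrite /step flat_le0 ?mul0r // subr_le0. Qed.

Lemma step1 x y : 0 < y -> 4 * x <= y -> step x y = 1.
Proof.
move=> y0 xy; rewrite /step (@flat_le0 _ _ (4 * x - y)) ?subr_le0 // addr0.
rewrite divff // gt_eqF // flat_gt0 // subr_gt0; lra.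
Qed.

Lemma step_den_gt0 x y : 0 < x \/ 0 < y ->
  0 < flat 0 (y - 2 * x) + flat 0 (4 * x - y).
Proof.
move=> xy; have [yx|yx] := leP y (2 * x).
  by rewrite ltr_wpDl ?flat_ge0 // flat_gt0 // subr_gt0; case: xy => ?; lra.
by rewrite ltr_pwDl ?flat_ge0 // flat_gt0 // subr_gt0.
Qed.

End Step.

Lemma elementary_step (R : realType) (V : normedModType R) (U : set V)
    (f g : V -> R) :
  (forall v, U v -> 0 < f v \/ 0 < g v) -> elementary U f -> elementary U g ->
  elementary U (fun v => step (f v) (g v)).
Proof.
move=> fg Uf Ug.
have UZ c (h : V -> R) : elementary U h -> elementary U (fun v => c * h v).
  by apply: elementaryM; exact: elementary_cst.
have U1 : elementary U (fun v => flat 0 (g v - 2 * f v)).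
  apply: elementary_flat; apply: (@elementary_eq _ _ _ (fun v => g v + -2 * f v)).
    by move=> v _; rewrite mulNr.
  by apply: elementaryD => //; exact: UZ.
have U2 : elementary U (fun v => flat 0 (4 * f v - g v)).
  apply: elementary_flat; apply: (@elementary_eq _ _ _ (fun v => 4 * f v + -1 * g v)).
    by move=> v _; rewrite mulN1r.
  by apply: elementaryD; exact: UZ.
apply: elementaryM => //; apply: elementaryV; last exact: elementaryD.
by move=> v /fg /step_den_gt0 /gt_eqF ->.
Qed.

Lemma elementary_prod (R : realType) (V : normedModType R) (U : set V)
    (T : choiceType) (A B : set T) (F : T -> V -> R) :
  finite_set B -> B `<=` A -> (forall p, B p -> elementary U (F p)) ->
  (forall p v, A p -> ~ B p -> U v -> F p v = 1) ->
  elementary U (fun v => \big[*%R/1]_(p \in A) F p v).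
Proof.
move=> finB BA UF F1.

apply: (@elementary_eq _ _ _ (fun v => \big[*%R/1]_(p <- fset_set B) F p v)).
  move=> v Uv; rewrite -fsbig_finite //; apply: fsbig_widen => // p [Ap nBp].
  exact: F1.
have : forall p, p \in (fset_set B : seq T) -> elementary U (F p).
  by move=> p; rewrite in_fset_set // => /set_mem; exact: UF.
elim: (fset_set B : seq T) => [_|p s IH UFs].
  by under eq_fun do rewrite big_nil; exact: elementary_cst.
under eq_fun do rewrite big_cons.
apply: elementaryM; first by apply: UFs; rewrite mem_head.
by apply: IH => q qs; apply: UFs; rewrite inE qs orbT.
Qed.

Lemma fsprod0 (R : realType) (T : choiceType) (A : set T) (F : T -> R) (p : T) :
  finite_set (A `&` [set q | F q != 1]) -> A p -> F p = 0 ->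
  \big[*%R/1]_(q \in A) F q = 0.
Proof.
move=> finF Ap Fp.
rewrite -(@fsbig_widen _ _ _ _ (A `&` [set q | F q != 1])); first last.
- by move=> q [Aq /not_andP[//|/negP]]; rewrite negbK => /eqP.
- by move=> q [].
rewrite (fsbigD1 p) //; first by rewrite /= Fp mul0r.
by split=> //=; rewrite Fp eq_sym oner_eq0.
Qed.

(** * The bump function *)

Section Bump.
Context {R : realType}.
Notation C0D := (C0 R Duplicate).
Implicit Types (f g : C0D) (p q : Duplicate).

Definition sq p f : R := f p ^+ 2.

Lemma sq_ge0 p f : 0 <= sq p f. Proof. exact: sqr_ge0. Qed.

Lemma C0_eval_subproof p : (fun f : C0D => f p : R^o) \in clin_pred (V := C0D) (W := R^o).
Proof.
apply/asboolP; split=> // f N /nbhs_ballP[e /= e0 eN].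
apply/nbhs_ballP; exists e => //= g; rewrite -ball_normE /= => fg.
apply: eN; rewrite -ball_normE /=.
exact: le_lt_trans (C0_norm_ge (f - g) p) fg.
Qed.

Definition C0_eval p : clin C0D R^o := MkClin (C0_eval_subproof p).

Lemma elementary_sq U p : elementary U (sq p).
Proof.
apply: (@elementary_eq _ _ _ (fun f => C0_eval p f * C0_eval p f)) => //.
by apply: elementaryM; exact: elementary_clin.
Qed.

Lemma elementary_gap U p : elementary U (fun f => 1 - sq p f).
Proof.
apply: (@elementary_eq _ _ _ (fun f => 1 + -1 * sq p f)).
  by move=> f _; rewrite mulN1r.
apply: elementaryD; first exact: elementary_cst.
by apply: elementaryM; [exact: elementary_cst | exact: elementary_sq].
Qed.

(** The values at all points move uniformly little. *)
Lemma sq_near f (d : R) : 0 < d -> exists U : set C0D,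
  [/\ open U, U f & forall g p, U g -> `|sq p g - sq p f| < d].
Proof.
move=> d0; pose r := Num.min 1 (d / (2 * `|f| + 1)).
have c0 : 0 < 2 * `|f| + 1 by rewrite ltr_wpDl // mulr_ge0.
have r0 : 0 < r by rewrite lt_min ltr01 divr_gt0.
exists (ball f r); split; [exact: ball_open | exact: ballxx |].
move=> g p; rewrite -ball_normE /= distrC => gf.
have gfp : `|g p - f p| < r := le_lt_trans (C0_norm_ge (g - f) p) gf.
rewrite /sq subr_sqr normrM.
have fp := C0_norm_ge f p.
have gp : `|g p + f p| <= 2 * `|f| + 1.
  rewrite -(subrK (f p) (g p)) -addrA (le_trans (ler_normD _ _)) //.
  have := ler_normD (f p) (f p).
  have : `|g p - f p| <= 1 by rewrite (le_trans (ltW gfp)) // ge_min lexx.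
  lra.
have rd : r * (2 * `|f| + 1) <= d by rewrite -ler_pdivlMr // ge_min lexx orbT.
apply: lt_le_trans rd; apply: le_lt_trans (ler_wpM2l (normr_ge0 _) gp) _.
by rewrite ltr_pM2r.
Qed.

Lemma sq_continuous f : continuous (sq ^~ f).
Proof.
move=> x; rewrite /sq; under eq_fun do rewrite expr2.
have fx : (f : Duplicate -> R) y @[y --> x] --> f x by exact: C0_continuous.
exact: (cvgM fx fx).
Qed.

Lemma sq_compact f (e : R) : 0 < e -> compact [set p | e <= sq p f].
Proof.
move=> e0; have := @C0_vanishes _ _ f (Num.sqrt e); rewrite sqrtr_gt0 => /(_ e0).
congr compact; apply/funext => p; apply/propext => /=.
by rewrite /sq -sqrtr_sqr ler_sqrt ?sqr_ge0 //.
Qed.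

Lemma succs_sq_finite f p (e : R) : 0 < e ->
  finite_set (succs p `&` [set q | e <= sq q f]).
Proof.
move=> e0; rewrite setIC; apply: compact_discrete_finite; first exact: sq_compact.
by move=> x _; exact: succs_discrete.
Qed.

Definition drop (d : R) f : set Duplicate :=
  [set p | forall q, succs p q -> sq q f <= sq p f - d].

Lemma drop_finite f (e d : R) : 0 < e -> 0 < d ->
  finite_set ([set p | e <= sq p f] `&` drop d f).
Proof.
move=> e0 d0; apply: compact_discrete_finite; first exact: sq_compact.
by move=> x _; apply: drop_discrete d0; exact: sq_continuous.
Qed.

(** The first factor makes [peak] vanish where f(p)^2 <= 7/8.  Where it does
    not vanish, only the finitely many successors with f(q)^2 > 1/2 contribute
    to the product, so the latter is meaningful. *)
Definition peak p f : R := step (1 - sq p f) (1 / 4) *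
  \big[*%R/1]_(q \in succs p) step (1 - sq p f) (1 - sq q f).

Lemma peak0 p f :
  sq p f <= 7 / 8 \/ (exists2 q, succs p q & 1 - sq q f <= 2 * (1 - sq p f)) ->
  peak p f = 0.
Proof.
rewrite /peak; have [small _|big [|[q pq qp]]] := leP (sq p f) (7 / 8).
- by rewrite step0 ?mul0r //; lra.
- by move=> h; lra.
rewrite (@fsprod0 _ _ _ _ q) ?mulr0 //; last exact: step0.
apply: sub_finite_set (@succs_sq_finite f p (1 / 2) _) => // q' [pq' /= h].
split=> //=; rewrite leNgt; apply/negP => q'2; move/negP: h; apply.
by rewrite step1 //; lra.
Qed.

Lemma peak1 p f : (forall q, succs p q ->
    0 < 1 - sq q f /\ 4 * (1 - sq p f) <= 1 - sq q f) ->
  4 * (1 - sq p f) <= 1 / 4 -> peak p f = 1.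
Proof.
move=> high p4; rewrite /peak step1 // mul1r fsbig1 // => q /high[? ?].
exact: step1.
Qed.

(** Inside the open unit ball almost all factors are 1, by [peak_near]. *)
Definition bump f : R^o := if `[< forall p, sq p f < 1 >] then
  \big[*%R/1]_(p \in [set: Duplicate]) (1 - peak p f) else 0.

Lemma sq_lt1_sup f (A : set Duplicate) :
  compact ([set p | 1 / 2 <= sq p f] `&` A) -> (forall p, A p -> sq p f < 1) ->
  exists m : R, [/\ 1 / 2 <= m, m < 1 & forall p, A p -> sq p f <= m].
Proof.
move=> cA A1; set K := _ `&` _ in cA.
have [K0|/set0P K0] := eqVneq K set0.
  exists (1 / 2); split=> // [|p Ap]; first by lra.
  rewrite leNgt; apply/negP => p2.
  have : K p by split=> //; exact: ltW.
  by rewrite K0.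
have [|c] := compact_EVT_max K0 cA (f := sq ^~ f).
  by apply: continuous_subspaceT; exact: sq_continuous.
rewrite inE => -[/= c2 Ac] cmax; exists (sq c f); split=> //; first exact: A1.
move=> p Ap; have [p2|/ltW p2] := leP (1 / 2) (sq p f); last exact: le_trans c2.
by apply: cmax; rewrite inE.
Qed.

(** With 1 - f^2 >= 32 d, let g^2 stay within d of f^2.  If f(p)^2 < 7/8 - d,
    then g(p)^2 < 7/8.  If f^2 falls by less than d at a successor q, then
    g(q)^2 > g(p)^2 - 3 d, whereas 1 - g(p)^2 >= 31 d; so the gap at q is less
    than twice the gap at p.  In both cases [peak p g] vanishes. *)
Lemma peak_near f : (forall p, sq p f < 1) ->
  exists U (P : set Duplicate), [/\ open U, U f, finite_set P,
    forall p, P p -> elementary U (peak p) &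
    forall g, U g -> (forall p, sq p g < 1) /\ forall p, ~ P p -> peak p g = 0].
Proof.
move=> f1; have [|m [m2 m1 fm]] := @sq_lt1_sup f setT _ (fun p _ => f1 p).
  by rewrite setIT; exact: sq_compact.
have {}fm p : sq p f <= m by exact: fm.
pose d := (1 - m) / 32; have dE : d * 32 = 1 - m by rewrite /d divfK.
have d0 : 0 < d by rewrite /d divr_gt0 // subr_gt0.
have [U [oU Uf Ud]] := sq_near f d0.
have {}Ud g p : U g -> sq p f - d < sq p g < sq p f + d.
  move=> Ug; have := Ud g p Ug; rewrite ltr_norml => /andP[? ?].
  by apply/andP; split; lra.
exists U, ([set p | 7 / 8 - d <= sq p f] `&` drop d f); split=> //.
- by apply: drop_finite => //; lra.
- move=> p [/= pf _]; apply: elementaryM.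
    apply: elementary_step; first by right; lra.
      exact: elementary_gap.
    exact: elementary_cst.
  (* The gap at p is at most 1/8 + 2 d, and d <= 1/64, so successors whose gap
     is above 3/4 contribute the factor 1. *)
  apply: (@elementary_prod _ _ _ _ _
    (succs p `&` [set q | 1 / 8 <= sq q f])).
  + by apply: succs_sq_finite; lra.
  + by move=> q [].
  + move=> q _; apply: elementary_step; [|exact: elementary_gap..].
    by move=> g Ug; left; have /andP[_] := Ud _ p Ug; have := fm p; lra.
  + move=> q g pq /not_andP[//|/= /negP]; rewrite -ltNge => qf Ug.
    have /andP[_ qg] := Ud _ q Ug; have /andP[pg _] := Ud _ p Ug.
    by apply: step1; lra.
- move=> g Ug; split=> [p|p nP].
    by have /andP[_] := Ud _ p Ug; have := fm p; lra.
  apply: peak0; have [psmall|pbig] := ltP (sq p f) (7 / 8 - d).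
    by left; have /andP[_] := Ud _ p Ug; lra.
  have : ~ drop d f p by move=> dp; apply: nP.
  move=> /existsNP[q /not_implyP[pq /negP]]; rewrite -ltNge => qp.
  right; exists q => //; have /andP[+ _] := Ud _ q Ug; have /andP[_] := Ud _ p Ug.
  by have := fm p; lra.
Qed.

Lemma peak_finite f : (forall p, sq p f < 1) ->
  finite_set [set p | peak p f != 0].
Proof.
move=> /peak_near[U [P [_ Uf Pfin _ /(_ f Uf)[_ P0]]]].
apply: sub_finite_set Pfin => p /= /eqP pf; apply: contrapT => nP.
exact/pf/P0.
Qed.

Lemma bump_out f p : 1 <= sq p f -> bump f = 0.
Proof.
by move=> pf; rewrite /bump; case: asboolP => // /(_ p); rewrite ltNge pf.
Qed.

(** The factor of a maximal point r of the set where |f| >= 1 vanishes near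
    f: the gap of g at the successors of r is bounded below by 15 d, and the
    gap at r is less than d. *)
Lemma bump_near_out f p : 1 <= sq p f ->
  exists U : set C0D, [/\ open U, U f & forall g, U g -> bump g = 0].
Proof.
move=> pf; have [||r rf rmax] := @compact_tree_maximal [set p | 1 <= sq p f].
- exact: sq_compact.
- by exists p.
have {}rmax q : succs r q -> sq q f < 1.
  by move=> [/rmax qf _]; rewrite ltNge; apply/negP.
have [|m [m2 m1 fm]] := @sq_lt1_sup f (succs r) _ rmax.
  by apply: finite_compact; rewrite setIC; apply: succs_sq_finite; lra.
pose d := (1 - m) / 16; have dE : d * 16 = 1 - m by rewrite /d divfK.
have d0 : 0 < d by rewrite /d divr_gt0 // subr_gt0.
have [U [oU Uf Ud]] := sq_near f d0.
exists U; split=> // g Ug; rewrite /bump; case: asboolP => // g1.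
have rg : 1 - d < sq r g.
  by have := Ud g r Ug; rewrite ltr_norml => /andP[+ _]; move: rf => /=; lra.
have rg1 : peak r g = 1.
  apply: peak1 => [q rq|]; last by lra.
  by have := Ud g q Ug; rewrite ltr_norml => /andP[_]; have := fm q rq; lra.
rewrite (@fsprod0 _ _ _ _ r) ?rg1 ?subrr //.
apply: sub_finite_set (peak_finite g1) => q [_ /=]; apply: contra => /eqP->.
by rewrite subr0.
Qed.

Lemma bump_locally_elementary : locally_elementary bump.
Proof.
move=> f; have [f1|/existsNP[p /negP]] := pselect (forall p, sq p f < 1).
  have [U [P [oU Uf Pfin UP P0]]] := peak_near f1.
  exists U, (fun g => (\big[*%R/1]_(p \in setT) (1 - peak p g)) *: (1 : R^o) + 0).
  split=> //.
    apply: elementary_mapD; last exact: elementary_map0.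
    apply: (elementary_prod Pfin) => // [p Pp|p g _ nP Ug]; last first.
      by have [_ ->//] := P0 g Ug; rewrite subr0.
    apply: (@elementary_eq _ _ _ (fun g => 1 + -1 * peak p g)).
      by move=> g _; rewrite mulN1r.
    apply: elementaryD; first exact: elementary_cst.
    by apply: elementaryM; [exact: elementary_cst | exact: UP].
  move=> g /P0[g1 _]; rewrite addr0 /bump; case: asboolP => // _.
  by rewrite [RHS]mulr1.
rewrite -leNgt => /bump_near_out[U [oU Uf U0]].
by exists U, (fun _ => 0); split=> //; exact: elementary_map0.
Qed.

Lemma bump0 : bump 0 = 1.
Proof.
have sq0 p : sq p 0 = 0 by rewrite /sq expr0n.
rewrite /bump; case: asboolP => [_|[p]]; last by rewrite sq0.
rewrite fsbig1 // => p _; rewrite peak0 ?subr0 // sq0; left; lra.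
Qed.

End Bump.

Unset Implicit Arguments.

Theorem mainTheorem3 (R : realType) :
  exists phi : C0 R Duplicate -> R^o, smooth_bump phi.
Proof.
exists bump; split.
- by exists 0; rewrite bump0 oner_neq0.
- exact/locally_elementary_smooth/bump_locally_elementary.
- exists [set f : C0 R Duplicate | `|f| <= 1].
    by exists 1; split=> // M M1 f /= /le_trans; apply; exact: ltW.
  move=> f nf; have [[p pf]|none] := pselect (exists p, 1 <= sq p f).
    exact: bump_out pf.
  exfalso; apply: nf; apply: C0_norm_le => // p.
  have [//|p1] := leP `|f p| 1; exfalso; apply: none; exists p.
  by rewrite /sq -real_normK ?num_real // expr_ge1 // ltW.
Qed.
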